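(* Let $m,n\geq k\geq 1$ be integers. Given $A\in\mathbb{R}^{m\times n}$, the following statements are equivalent: (1) The matrix $A$ is totally negative of order $k$. (2) For every square submatrix $A_r$ of $A$ of size $r\in[1,k]$, $\mathrm{LCP}(A_r,q)$ has exactly two solutions for all $q\in\mathbb{R}^r$ with $q>0$. (3) For every contiguous square submatrix $A_r$ of $A$ of size $r\in[1,k]$, $\mathrm{LCP}(A_r,q)$ has exactly two solutions for all $q\in\mathbb{R}^r$ with $q>0$. (4) For every contiguous square submatrix $A_r$ of $A$ of size $r\in[2,k]$ and for all $q\in\mathbb{R}^r$ with $q>0$, $\mathrm{SOL}(A_r,q)$ does not contain two vectors which have sign patterns $(+,0,+,0,\ldots)^T$ and $(0,+,0,+,\ldots)^T$ respectively. Moreover, for $r=1$ and all $i\in[1,m]$, $j\in[1,n]$, $\mathrm{LCP}((a_{ij})_{1\times1},q)$ has exactly two solutions for some scalar $q>0$.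
   Context: A real matrix is totally negative of order $k$ if all its minors of order at most $k$ are negative. A contiguous submatrix is a submatrix whose rows and columns are indexed by sets of consecutive integers. $[a,b]$ is the set of integers from $a$ to $b$. For vectors, $q>0$ (resp. $q\ge0$) means all coordinates are positive (resp. non-negative). For $M\in\mathbb{R}^{r\times r}$ and $q\in\mathbb{R}^r$, the Linear Complementarity Problem $\mathrm{LCP}(M,q)$ asks for $x\in\mathbb{R}^r$ with $x\geq0$, $y=Mx+q\geq0$ and $x^Ty=0$; such an $x$ is called a solution, and $\mathrm{SOL}(M,q)$ is the set of all solutions. A vector in $\mathbb{R}^r$ has sign pattern $(+,0,+,0,\ldots)^T$ if its odd-indexed coordinates are positive and its even-indexed coordinates are zero; it has sign pattern $(0,+,0,+,\ldots)^T$ if its odd-indexed coordinates are zero and its even-indexed coordinates are positive. *)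

(* Defs.v *)
From mathcomp Require Import all_boot all_order all_algebra.
From mathcomp Require Import classical_sets reals.

Set Implicit Arguments.
Unset Strict Implicit.
Unset Printing Implicit Defensive.

Import Order.TTheory GRing.Theory Num.Theory.

Local Open Scope ring_scope.
Local Open Scope classical_set_scope.

Definition increasing_idx (r m : nat) (f : 'I_r -> 'I_m) : Prop :=
  forall i j : 'I_r, (i < j)%N -> (f i < f j)%N.

(* The values of an increasing f are consecutive integers. *)
Definition consecutive_idx (r m : nat) (f : 'I_r -> 'I_m) : Prop :=
  forall i j : 'I_r, j = i.+1 :> nat -> f j = (f i).+1 :> nat.

Section Matrices.
Variable R : realType.

Definition square_submatrix (m n r : nat) (A : 'M[R]_(m, n)) (B : 'M[R]_r)
    : Prop :=
  exists f : 'I_r -> 'I_m, exists g : 'I_r -> 'I_n,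
    [/\ increasing_idx f, increasing_idx g & B = mxsub f g A].

Definition contiguous_square_submatrix (m n r : nat) (A : 'M[R]_(m, n))
    (B : 'M[R]_r) : Prop :=
  exists f : 'I_r -> 'I_m, exists g : 'I_r -> 'I_n,
    [/\ increasing_idx f /\ consecutive_idx f,
        increasing_idx g /\ consecutive_idx g
      & B = mxsub f g A].

Definition totally_negative (m n k : nat) (A : 'M[R]_(m, n)) : Prop :=
  forall (r : nat) (B : 'M[R]_r),
    (1 <= r <= k)%N -> square_submatrix A B -> \det B < 0.

Definition vpos (r : nat) (q : 'cV[R]_r) : Prop := forall i, 0 < q i 0.

Definition vnonneg (r : nat) (q : 'cV[R]_r) : Prop := forall i, 0 <= q i 0.

Definition SOL (r : nat) (M : 'M[R]_r) (q : 'cV[R]_r) : set 'cV[R]_r :=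
  [set x | [/\ vnonneg x, vnonneg (M *m x + q) & x^T *m (M *m x + q) = 0]].

Definition exactly_two_solutions (r : nat) (M : 'M[R]_r) (q : 'cV[R]_r)
    : Prop :=
  exists x1 x2 : 'cV[R]_r, x1 <> x2 /\ SOL M q = [set x1; x2].

(* Ordinals start at 0, so the 1-based odd coordinates are those with even
   index here. *)
Definition sign_pattern_plus_zero (r : nat) (x : 'cV[R]_r) : Prop :=
  forall i : 'I_r, (~~ odd i -> 0 < x i 0) /\ (odd i -> x i 0 = 0).

Definition sign_pattern_zero_plus (r : nat) (x : 'cV[R]_r) : Prop :=
  forall i : 'I_r, (~~ odd i -> x i 0 = 0) /\ (odd i -> 0 < x i 0).

End Matrices.

(* Main.v *)
Require Import Defs.
From mathcomp Require Import all_boot all_order all_algebra.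
From mathcomp Require Import classical_sets reals.
From mathcomp Require Import boolp cardinality topology normedtype.
From mathcomp Require Import ring lra.

(** Write [y = M x + q] for the slack of a vector [x].

    Total negativity implies two solutions.  A submatrix [M] of the given matrix
    has negative entries and negative principal minors.  Say that [M] reverses
    [x] when [x_i (M x)_i <= 0] for all [i]; the difference of two solutions of
    the same problem is always reversed.  If moreover [(M x)_i = 0] for some [i],
    the sign condition can be written as a singular system [(E M + F) x = 0] with
    nonnegative diagonal [E] and [F], [F_i = 0], whose determinant is a
    nonzero, nonnegative combination of principal minors of [M] of positive order,
    hence negative: so [x = 0] ([reversed_with_zero]).  A perturbation argument deduces
    that a reversed vector has constant sign ([reversed_one_signed]).  Two
    solutions are therefore comparable, and as [M] has negative entries, the
    larger one has the strictly smaller slack, which forces the smaller solution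
    to be zero: at most one solution is nonzero.

    A nonzero solution exists because the Schur complement [K] of [M] at its first
    entry reverses no nonzero vector, so that every problem for [K] has exactly
    one solution.  Prescribing the first slack [y_0 = t] turns the other
    coordinates into such a problem and leaves [x_0] free, which traces a curve
    over [0 <= t <= q_0].  It leaves the zero solution at [t = q_0] with [x_0 > 0]
    just below; as [t] decreases, either [x_0 >= 0] still holds at [t = 0], or
    [x_0] vanishes on the way, and both cases give a nonzero solution
    ([nonzero_solution]).  The same device, an intermediate value argument along a
    line of right-hand sides ([nonreversing_line_ivt]), proves by induction on the
    size that problems for non-reversing matrices are solvable
    ([nonreversing_solvable]).

    The last condition implies total negativity, by induction on the order [p] of
    the minors.  If all smaller minors are negative and a contiguous minor of
    order [p] is nonnegative, the adjugate of that block yields an alternating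
    vector which the block reverses; its positive and negative parts solve a
    common problem with [q > 0] and have the two forbidden sign patterns
    ([alternating_solutions]).  So contiguous minors of order [p] are negative,
    and a Fekete-type argument extends this to all minors of order [p]
    ([fekete]). *)

Set Implicit Arguments.
Unset Strict Implicit.
Unset Printing Implicit Defensive.

Import Order.TTheory GRing.Theory Num.Theory.
Import numFieldNormedType.Exports.

Local Open Scope ring_scope.
Local Open Scope classical_set_scope.

(** * From contiguous minors to all minors *)

(** The left-hand side is the Laplace expansion, along the first column, of the
    determinant of [Y] with its own column [j] repeated in front. *)
Lemma left_kernel_minors (F : comNzRingType) (p : nat) (Y : 'M[F]_(p.+1, p))
    (j : 'I_p) :
  \sum_(i < p.+1) (-1) ^+ i * \det (row' i Y) * Y i j = 0.
Proof.
pose Z : 'M[F]_p.+1 := \matrix_(i, l) oapp (Y i) (Y i j) (unlift ord0 l).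
have detZ0 : \det Z = 0.
  rewrite -det_tr; apply: (@determinant_alternate _ _ _ ord0 (lift ord0 j)) => // i.
  by rewrite !mxE unlift_none liftK.
rewrite -[RHS]detZ0 (expand_det_col _ ord0); apply: eq_bigr => i _.
rewrite mxE unlift_none mulrC /cofactor addn0; congr (_ * (_ * \det _)).
by apply/matrixP=> a b; rewrite !mxE liftK.
Qed.

Lemma lift_increasing n (i : 'I_n.+1) : increasing_idx (lift i).
Proof. by move=> a b; rewrite !ltnNge (leq_bump2 i b a). Qed.

Section Fekete.
Variable R : realType.

(** The signed maximal minors [w] of [X] span its left kernel.  Without the last
    column the left kernel becomes two-dimensional, spanned by the vectors [u] and
    [v] of signed minors that avoid the last and the first row.  Both alternate in
    sign, and the two extreme entries of [w] give the coefficients of [w] on [u]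
    and [v] the signs that make every entry of [w] alternate as well. *)
Lemma middle_minor_neg (p : nat) (X : 'M[R]_(p.+2, p.+1)) :
  (forall f : 'I_p -> 'I_p.+2, increasing_idx f ->
     \det (mxsub f (lift ord_max) X) < 0) ->
  \det (row' ord0 X) < 0 -> \det (row' ord_max X) < 0 ->
  forall s, \det (row' s X) < 0.
Proof.
move=> minors_neg top_neg bot_neg s.
pose w i := (-1) ^+ nat_of_ord i * \det (row' i X).
pose Y := col' ord_max X.
pose dm i := \det (row' i (row' ord_max Y)).
pose d0 i := \det (row' i (row' ord0 Y)).
have dm_neg i : dm i < 0.
  have -> : dm i = \det (mxsub (lift ord_max \o lift i) (lift ord_max) X).
    by congr (\det _); apply/matrixP=> a b; rewrite !mxE.
  by apply: minors_neg => a b ab; apply/lift_increasing/lift_increasing.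
have d0_neg i : d0 i < 0.
  have -> : d0 i = \det (mxsub (lift ord0 \o lift i) (lift ord_max) X).
    by congr (\det _); apply/matrixP=> a b; rewrite !mxE.
  by apply: minors_neg => a b ab; apply/lift_increasing/lift_increasing.
pose u i := oapp (fun k : 'I_p.+1 => (-1) ^+ k * dm k) 0 (unlift ord_max i).
pose v i := oapp (fun k : 'I_p.+1 => (-1) ^+ k * d0 k) 0 (unlift ord0 i).
have kerw j : \sum_i w i * Y i j = 0.
  rewrite -[RHS](left_kernel_minors X (lift ord_max j)).
  by apply: eq_bigr => i _; rewrite [Y _ _]mxE.
have keru j : \sum_i u i * Y i j = 0.
  rewrite big_ord_recr /= /u unlift_none mul0r addr0.
  rewrite -[RHS](left_kernel_minors (row' ord_max Y) j).
  apply: eq_bigr => i _; have -> : widen_ord (leqnSn p.+1) i = lift ord_max i.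
    by apply: val_inj; rewrite /= /bump leqNgt ltn_ord.
  by rewrite liftK [in RHS]mxE.
have kerv j : \sum_i v i * Y i j = 0.
  rewrite big_ord_recl /= /v unlift_none mul0r add0r.
  rewrite -[RHS](left_kernel_minors (row' ord0 Y) j).
  by apply: eq_bigr => i _; rewrite liftK [in RHS]mxE.
pose alpha := \det (row' ord0 X) / dm ord0.
pose beta := - \det (row' ord_max X) / d0 ord_max.
have alpha_gt0 : 0 < alpha by rewrite nmulr_rgt0 // invr_lt0.
have beta_lt0 : beta < 0 by rewrite nmulr_llt0 ?invr_lt0 // oppr_gt0.
have u0 : u ord0 = dm ord0.
  have e : ord0 = lift ord_max ord0 :> 'I_p.+2 by apply: val_inj.
  by rewrite /u {1}e liftK /= expr0 mul1r.
have um : u ord_max = 0 by rewrite /u unlift_none.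
have v0 : v ord0 = 0 by rewrite /v unlift_none.
have vm : v ord_max = (-1) ^+ p * d0 ord_max.
  have e : ord_max = lift ord0 ord_max :> 'I_p.+2 by apply: val_inj.
  by rewrite /v {1}e liftK.
pose z i := w i - alpha * u i - beta * v i.
have z0 : z ord0 = 0.
  by rewrite /z u0 v0 mulr0 subr0 divfK ?lt_eqF// /w expr0 mul1r subrr.
have zm : z ord_max = 0.
  rewrite /z um vm mulr0 subr0 mulrCA divfK ?lt_eqF// /w exprS.
  by rewrite mulrN opprK !mulN1r mulNr addNr.
have kerz j : \sum_i z i * Y i j = 0.
  transitivity (\sum_i (w i * Y i j - alpha * (u i * Y i j)
                       - beta * (v i * Y i j))).
    by apply: eq_bigr => i _; rewrite !mulrBl !mulrA.
  by rewrite !sumrB -!mulr_sumr kerw keru kerv !mulr0 !subr0.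
(* z is a kernel vector supported on the p inner rows, which are independent. *)
pose mid (i : 'I_p) : 'I_p.+2 := lift ord0 (lift ord_max i).
have zmid i : z (mid i) = 0.
  pose C := mxsub mid (lift ord_max) X.
  have C_unit : C \in unitmx.
    rewrite unitmxE unitfE lt_eqF//; apply: minors_neg => a b ab.
    exact/lift_increasing/lift_increasing.
  have : (\row_i z (mid i)) *m C = 0.
    apply/rowP=> j; rewrite !mxE -[RHS](kerz j) big_ord_recl z0 mul0r add0r.
    rewrite big_ord_recr /=.
    have -> : lift ord0 ord_max = ord_max :> 'I_p.+2 by apply: val_inj.
    rewrite zm mul0r addr0; apply: eq_bigr => k _; rewrite !mxE /mid.
    have -> : widen_ord (leqnSn p) k = lift ord_max k; last by [].
    by apply: val_inj; rewrite /= /bump leqNgt ltn_ord.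
  move/(congr1 (mulmx^~ (invmx C))); rewrite mulmxK // mul0mx.
  by move/rowP=> /(_ i); rewrite !mxE.
case: (unliftP ord0 s) => [s'|] -> //.
case: (unliftP ord_max s') => [i|] ->; last first.
  have -> : lift ord0 ord_max = ord_max :> 'I_p.+2 by apply: val_inj.
  by [].
have bump_small h k : (k < h)%N -> bump h k = k.
  by move=> kh; rewrite /bump leqNgt kh.
have e : mid i = lift ord_max (lift ord0 i).
  apply: val_inj; change (bump 0 (bump p i) = bump p.+1 (bump 0 i)).
  by rewrite (bump_small p.+1) ?(bump_small p) // ltnS.
have := zmid i; rewrite /z /w /v liftK /u e liftK /= -e.
rewrite -/(mid i); set D := \det (row' (mid i) X).
rewrite (bump_small p.+1) ?(bump_small p) ?ltnS //.
rewrite (exprS _ i : (-1) ^+ bump 0 i = _).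
set b := _ ^+ i; move=> eqD.
have : b * (alpha * dm (lift ord0 i) - beta * d0 (lift ord_max i) - D) = 0.
  by rewrite -[RHS]eqD; ring.
move/eqP; rewrite mulf_eq0 signr_eq0 /= subr_eq0 => /eqP <-.
have : alpha * dm (lift ord0 i) < 0 by rewrite pmulr_rlt0.
have : 0 < beta * d0 (lift ord_max i) by rewrite nmulr_rgt0.
lra.
Qed.

(** By induction on the spread [f ord_max - f ord0]: adding to the index set an
    index [h] from one of its gaps, and then deleting either end, gives index sets
    of smaller spread, while deleting [h] gives back the original one, so that
    [middle_minor_neg] applies. *)
Lemma fekete_rows (m p : nat) (W : 'M[R]_(m, p.+1)) :
  (forall f : 'I_p -> 'I_m, increasing_idx f ->
     \det (mxsub f (lift ord_max) W) < 0) ->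
  (forall f : 'I_p.+1 -> 'I_m, increasing_idx f -> consecutive_idx f ->
     \det (rowsub f W) < 0) ->
  forall f : 'I_p.+1 -> 'I_m, increasing_idx f -> \det (rowsub f W) < 0.
Proof.
move=> minors_neg cont_neg f.
have [d le_d] := ubnP (f ord_max - f ord0); elim: d f le_d => // d IHd f le_d f_incr.
case: (boolP [forall i : 'I_p.+1, forall j : 'I_p.+1,
                (j == i.+1 :> nat) ==> (f j == (f i).+1 :> nat)]) => [cons_f|].
  apply: cont_neg => // i j ij; apply/eqP.
  by have /forallP/(_ i)/forallP/(_ j)/implyP -> := cons_f; rewrite ?ij.
rewrite negb_forall => /existsP[i]; rewrite negb_forall => /existsP[j].
rewrite negb_imply => /andP[/eqP ij fij].
have fi_lt_fj : (f i < f j)%N by apply: f_incr; rewrite ij.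
have h_lt_fj : ((f i).+1 < f j)%N by rewrite ltn_neqAle eq_sym fij.
pose h := Ordinal (ltn_trans h_lt_fj (ltn_ord (f j))).
pose s : 'I_p.+2 := inord i.+1.
have sE : s = i.+1 :> nat by rewrite inordK // ltnS.
pose u l := oapp f h (unlift s l).
have f_mono (a b : 'I_p.+1) : (a <= b)%N -> (f a <= f b)%N.
  by rewrite leq_eqVlt => /predU1P[/ord_inj->|/f_incr/ltnW].
have u_incr : increasing_idx u.
  move=> a b; rewrite /u.
  case: (unliftP s a) => [a'|] ->; case: (unliftP s b) => [b'|] -> ab /=.
  - by apply: f_incr; move: ab; rewrite !ltnNge (leq_bump2 s b' a').
  - rewrite ltnS f_mono // leqNgt; apply/negP => ia'.
    have : (bump s a' < s)%N by [].
    by rewrite /bump sE ia' ltnNge ltnW // ltnS ltnW.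
  - apply: (leq_trans h_lt_fj); rewrite f_mono // ij leqNgt ltnS.
    apply/negP => b'i; have : (s < bump s b')%N by [].
    by rewrite /bump sE (ltnNge i b') b'i add0n ltnNge ltnW.
  - by move: ab; rewrite ltnn.
have fE : f =1 u \o lift s by move=> l; rewrite /u /= liftK.
have -> : rowsub f W = row' s (rowsub u W).
  by apply/matrixP=> a b; rewrite !mxE fE.
have u0 : u ord0 = f ord0.
  by rewrite [RHS]fE; congr u; apply: val_inj; rewrite /= /bump sE.
have um : u ord_max = f ord_max.
  rewrite [RHS]fE; congr u; apply: val_inj; rewrite /= /bump sE.
  by have := ltn_ord j; rewrite ij ltnS => ->.
have fm_gt0 : (f ord0 < f ord_max)%N.
  apply: leq_ltn_trans (f_mono _ i _) (leq_trans fi_lt_fj (f_mono _ _ _)) => //.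
  by rewrite -ltnS.
have row'_lt (t : 'I_p.+2) :
    (u (lift t (ord_max : 'I_p.+1)) - u (lift t (ord0 : 'I_p.+1)) <
     f ord_max - f ord0)%N ->
    \det (row' t (rowsub u W)) < 0.
  move=> lt_t; have -> : row' t (rowsub u W) = rowsub (u \o lift t) W.
    by apply/matrixP=> a b; rewrite !mxE.
  apply: IHd; first exact: leq_trans lt_t le_d.
  by move=> a b ab; apply/u_incr/lift_increasing.
apply: middle_minor_neg.
- move=> g g_incr; have -> : mxsub g (lift ord_max) (rowsub u W) =
    mxsub (u \o g) (lift ord_max) W by apply/matrixP=> a b; rewrite !mxE.
  by apply: minors_neg => a b ab; apply/u_incr/g_incr.
- apply: row'_lt; have -> : lift ord0 ord_max = ord_max :> 'I_p.+2.
    exact: val_inj.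
  rewrite um -u0 ltn_sub2l //; first by rewrite u0.
  exact: u_incr.
- apply: row'_lt; have -> : lift ord_max ord0 = ord0 :> 'I_p.+2.
    exact: val_inj.
  have lt_m : (u (lift ord_max (ord_max : 'I_p.+1)) < u ord_max)%N.
    by apply: u_incr; rewrite /= /bump ltnn.
  by rewrite u0 ltn_sub2r // -um.
Qed.

Lemma square_submatrix_trans (m n r p : nat) (A : 'M[R]_(m, n)) (B : 'M[R]_r)
    (C : 'M[R]_p) :
  square_submatrix A B -> square_submatrix B C -> square_submatrix A C.
Proof.
move=> [f [g [f_incr g_incr ->]]] [f' [g' [f'_incr g'_incr ->]]].
exists (f \o f'), (g \o g'); split; last by apply/matrixP=> i j; rewrite !mxE.
- by move=> i j ij; apply/f_incr/f'_incr.
- by move=> i j ij; apply/g_incr/g'_incr.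
Qed.

Lemma square_submatrix_minor (r : nat) (B : 'M[R]_r.+1) (i j : 'I_r.+1) :
  square_submatrix B (row' i (col' j B)).
Proof.
exists (lift i), (lift j); split; [exact: lift_increasing..|].
by apply/matrixP=> a b; rewrite !mxE.
Qed.

Lemma totally_negative_entry (m n k : nat) (A : 'M[R]_(m, n)) :
  totally_negative k.+1 A -> forall i j, A i j < 0.
Proof.
move=> A_neg i j; rewrite -[A i j](_ : \det (mxsub (fun=> i) (fun=> j) A : 'M_1) = _).
  apply: A_neg => //; exists (fun=> i), (fun=> j).
  by split=> // a b; rewrite !ord1.
by rewrite det_mx11 mxE.
Qed.

(** [fekete_rows] first frees the rows over a fixed window of consecutive columns;
    applied to the transpose, it then frees the columns over arbitrary fixed
    rows. *)
Lemma fekete (m n p : nat) (A : 'M[R]_(m, n)) :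
  totally_negative p A ->
  (forall B : 'M[R]_p.+1, contiguous_square_submatrix A B -> \det B < 0) ->
  totally_negative p.+1 A.
Proof.
move=> A_neg cont_neg r B /andP[r_gt0]; rewrite leq_eqVlt => /predU1P[rE|]; last first.
  by rewrite ltnS => le_rp; apply: A_neg; rewrite r_gt0.
subst r; case: p => [|p] in A_neg cont_neg B r_gt0 *.
  case=> f [g [f_incr g_incr ->]]; apply: cont_neg; exists f, g.
  by split=> //; split=> // a b; rewrite !ord1.
have minor_neg (f : 'I_p.+1 -> 'I_m) (g : 'I_p.+1 -> 'I_n) :
    increasing_idx f -> increasing_idx g -> \det (mxsub f g A) < 0.
  by move=> f_incr g_incr; apply: A_neg; [rewrite ltnSn|exists f, g].
have lift_incr k (g : 'I_p.+2 -> 'I_k) :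
  increasing_idx g -> increasing_idx (g \o lift ord_max).
  by move=> g_incr a b ab; apply/g_incr/lift_increasing.
case=> f [g [f_incr g_incr ->]].
rewrite -det_tr.
have -> : (mxsub f g A)^T = rowsub g (rowsub f A)^T.
  by apply/matrixP=> a b; rewrite !mxE.
apply: fekete_rows => // [h h_incr|{}g {}g_incr g_cons]; rewrite -det_tr.
  have -> : (mxsub h (lift ord_max) (rowsub f A)^T)^T =
      mxsub (f \o lift ord_max) h A by apply/matrixP=> a b; rewrite !mxE.
  by apply: minor_neg => //; apply: lift_incr.
have -> : (rowsub g (rowsub f A)^T)^T = rowsub f (colsub g A).
  by apply/matrixP=> a b; rewrite !mxE.
apply: fekete_rows => // [h h_incr|{}f {}f_incr f_cons].
  have -> : mxsub h (lift ord_max) (colsub g A) = mxsub h (g \o lift ord_max) A.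
    by apply/matrixP=> a b; rewrite !mxE.
  by apply: minor_neg => //; apply: lift_incr.
apply: cont_neg; exists f, g; split=> //.
by apply/matrixP=> a b; rewrite !mxE.
Qed.

End Fekete.

(** * Alternating solutions *)

Lemma SOLP (R : realType) (r : nat) (M : 'M[R]_r) (q x : 'cV[R]_r) :
  SOL M q x <-> forall i, [/\ 0 <= x i 0, 0 <= (M *m x + q) i 0
                            & x i 0 * (M *m x + q) i 0 = 0].
Proof.
split=> [[x0 y0 xy] i|H].
  split=> //; move/matrixP/(_ 0 0): xy; rewrite mxE [RHS]mxE => /eqP.
  rewrite psumr_eq0 => [/allP/(_ i)|j _]; last by rewrite mxE mulr_ge0.
  by rewrite mem_index_enum mxE => /(_ isT) /eqP.
split=> [i|i|]; [by case: (H i)|by case: (H i)|].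
apply/matrixP=> a b; rewrite !ord1 mxE [RHS]mxE big1 // => i _.
by rewrite mxE; case: (H i).
Qed.

Section AlternatingSolutions.
Variable R : realType.

Lemma colD (r : nat) (x y : 'cV[R]_r) (i : 'I_r) :
  (x + y) i 0 = x i 0 + y i 0.
Proof. by rewrite mxE. Qed.

Lemma colZ (r : nat) (s : R) (x : 'cV[R]_r) (i : 'I_r) :
  (s *: x) i 0 = s * x i 0.
Proof. by rewrite mxE. Qed.

Lemma colN (r : nat) (x : 'cV[R]_r) (i : 'I_r) : (- x) i 0 = - x i 0.
Proof. by rewrite mxE. Qed.

Lemma col0 (r : nat) (i : 'I_r) : (0 : 'cV[R]_r) i 0 = 0.
Proof. by rewrite mxE. Qed.

Lemma neg_mulmx_lt0 (r : nat) (B : 'M[R]_r) (x : 'cV[R]_r) (j : 'I_r) :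
  (forall i l, B i l < 0) -> vnonneg x -> 0 < x j 0 ->
  forall i, (B *m x) i 0 < 0.
Proof.
move=> B_neg x_ge0 xj i; rewrite mxE (bigD1 j) //=.
apply: ltr_wnDr; last by rewrite nmulr_rlt0.
by apply: sumr_le0 => l _; rewrite nmulr_rle0.
Qed.

(** The vector [z = \adj B *m v] alternates in sign because the minors of order
    one less are negative, and [B *m z = \det B *: v] weakly opposes it.  Taking for
    [q] the larger of [- B x] and [- B y], where [z = x - y] splits [z] into its
    positive and negative parts, puts the zero slacks of [x] at the even indices
    and those of [y] at the odd ones; [q] is positive as the entries of [B] are
    negative. *)
Lemma alternating_solutions (r : nat) (B : 'M[R]_r.+2) :
  (forall i j, B i j < 0) -> (forall i j, \det (row' i (col' j B)) < 0) ->
  0 <= \det B ->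
  exists q, vpos q /\ exists x y, [/\ SOL B q x, SOL B q y,
    sign_pattern_plus_zero x & sign_pattern_zero_plus y].
Proof.
move=> B_neg minors_neg detB.
pose v : 'cV[R]_r.+2 := \col_i (- (-1) ^+ nat_of_ord i).
pose z := \adj B *m v.
have z_alt (i : 'I_r.+2) : 0 < (-1) ^+ i * z i 0.
  have termE j : (-1) ^+ i * (\adj B i j * v j 0) = - \det (row' j (col' i B)).
    rewrite !mxE /cofactor exprD; set d := \det _.
    have := sqrr_sign R i; have := sqrr_sign R j.
    rewrite !expr2; set a := _ ^+ i; set b := _ ^+ j => b2 a2.
    transitivity (- (a * a) * (b * b) * d); first by ring.
    by rewrite a2 b2 !mulN1r.
  rewrite mxE mulr_sumr (bigD1 ord0) //= ltr_pwDl ?termE ?oppr_gt0 //.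
  by apply: sumr_ge0 => j _; rewrite termE oppr_ge0 ltW.
pose x := \col_(i < r.+2) (if odd i then 0 else z i 0).
pose y := \col_(i < r.+2) (if odd i then - z i 0 else 0).
have z_even (i : 'I_r.+2) : ~~ odd i -> 0 < z i 0.
  by move=> oi; have := z_alt i; rewrite -signr_odd (negPf oi) mul1r.
have z_odd (i : 'I_r.+2) : odd i -> 0 < - z i 0.
  by move=> oi; have := z_alt i; rewrite -signr_odd oi mulN1r.
have x_ge0 : vnonneg x.
  by move=> i; rewrite mxE; case: ifPn => // /z_even /ltW.
have y_ge0 : vnonneg y.
  by move=> i; rewrite mxE; case: ifPn => // /z_odd /ltW.
have Bx_lt0 := neg_mulmx_lt0 (j := ord0) B_neg x_ge0.
have By_lt0 := neg_mulmx_lt0 (j := lift ord0 ord0) B_neg y_ge0.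
have {}Bx_lt0 i : (B *m x) i 0 < 0 by apply: Bx_lt0; rewrite mxE z_even.
have {}By_lt0 i : (B *m y) i 0 < 0 by apply: By_lt0; rewrite mxE z_odd.
have Bxy (i : 'I_r.+2) : (B *m x) i 0 - (B *m y) i 0 = \det B * - (-1) ^+ i.
  transitivity ((B *m (x - y)) i 0); first by rewrite mulmxBr !mxE.
  have -> : x - y = z.
    by apply/matrixP=> a b; rewrite ord1 !mxE; case: ifP; rewrite ?subr0 ?sub0r ?opprK.
  by rewrite /z mulmxA mul_mx_adj mul_scalar_mx !mxE.
pose q := \col_i Num.max (- (B *m x) i 0) (- (B *m y) i 0).
have q_even (i : 'I_r.+2) : ~~ odd i -> q i 0 = - (B *m x) i 0.
  move=> oi; rewrite mxE max_l // lerN2 -subr_le0 Bxy -signr_odd (negPf oi).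
  by rewrite mulrN1 oppr_le0.
have q_odd (i : 'I_r.+2) : odd i -> q i 0 = - (B *m y) i 0.
  move=> oi; rewrite mxE max_r // lerN2 -subr_ge0 Bxy -signr_odd oi.
  by rewrite opprK mulr1.
have q_x i : - (B *m x) i 0 <= q i 0 by rewrite [q _ _]mxE le_max lexx.
have q_y i : - (B *m y) i 0 <= q i 0 by rewrite [q _ _]mxE le_max lexx orbT.
exists q; split.
  by move=> i; apply: lt_le_trans (q_x i); rewrite oppr_gt0.
have addE w i : (B *m w + q) i 0 = (B *m w) i 0 + q i 0 by rewrite mxE.
exists x, y; split; [apply/SOLP => i|apply/SOLP => i| |].
- split; rewrite ?addE; [exact: x_ge0|by rewrite -lerBlDl sub0r|].
  have [oi|oi] := boolP (odd i); first by rewrite mxE oi mul0r.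
  by rewrite q_even // subrr mulr0.
- split; rewrite ?addE; [exact: y_ge0|by rewrite -lerBlDl sub0r|].
  have [oi|oi] := boolP (odd i); last by rewrite mxE (negPf oi) mul0r.
  by rewrite q_odd // subrr mulr0.
- by move=> i; split=> oi; rewrite mxE ?oi ?(negPf oi) ?z_even.
- by move=> i; split=> oi; rewrite mxE ?oi ?(negPf oi) ?z_odd.
Qed.

Lemma contiguous_order_step (m n p k : nat) (A : 'M[R]_(m, n)) :
  (p < k)%N -> totally_negative p A -> (forall i j, A i j < 0) ->
  (forall (r : nat) (B : 'M[R]_r), (2 <= r <= k)%N ->
      contiguous_square_submatrix A B ->
      forall q : 'cV[R]_r, vpos q ->
      ~ (exists x y : 'cV[R]_r,
           [/\ SOL B q x, SOL B q y,
               sign_pattern_plus_zero x & sign_pattern_zero_plus y])) ->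
  totally_negative p.+1 A.
Proof.
move=> ltpk A_neg A_neg1 no_alt; apply: fekete => // B contB.
have [f [g [[f_incr _] [g_incr _] BE]]] := contB.
have subB : square_submatrix A B by exists f, g.
case: p => [|p] in ltpk A_neg B contB f g f_incr g_incr BE subB *.
  by rewrite det_mx11 BE mxE.
rewrite ltNge; apply/negP => detB.
have [||q [q_gt0 alt]] := alternating_solutions _ _ detB.
- by move=> i j; rewrite BE mxE.
- move=> i j; apply: A_neg; first by rewrite ltnSn.
  exact: square_submatrix_trans subB (square_submatrix_minor _ _ _).
- exact: no_alt contB _ q_gt0 alt.
Qed.

End AlternatingSolutions.

(** * Sign reversal *)

Section SignReversal.
Variable R : realType.

(** The determinant of this matrix is the principal minor of [M] on the index set
    [J], without reindexing by the elements of [J]. *)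
Definition select_rows (r : nat) (J : {set 'I_r}) (M : 'M[R]_r) : 'M[R]_r :=
  \matrix_(i, j) (if i \in J then M i j else (i == j)%:R).

Lemma det_select_rows_neg (r : nat) (M : 'M[R]_r) (J : {set 'I_r}) (a : 'I_r) :
  totally_negative r M -> a \in J -> \det (select_rows J M) < 0.
Proof.
elim: r M J a => [|r IHr] M J a M_neg aJ; first by case: a aJ.
have [->|] := eqVneq J [set: 'I_r.+1]%SET.
  have -> : select_rows [set: 'I_r.+1]%SET M = M.
    by apply/matrixP=> i j; rewrite mxE inE.
  apply: M_neg; first by rewrite ltnSn.
  by exists id, id; split=> //; apply/matrixP=> i j; rewrite mxE.
rewrite -finset.subTset => /subsetPn[j _ jJ].
have -> : \det (select_rows J M) =
    \det (select_rows [set l | lift j l \in J]%SET (row' j (col' j M))).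
  rewrite (expand_det_row _ j) (bigD1 j) //= big1 => [|l lj]; last first.
    by rewrite mxE (negPf jJ) eq_sym (negPf lj) mul0r.
  rewrite addr0 mxE (negPf jJ) eqxx mul1r /cofactor addnn -signr_odd odd_double mul1r.
  congr (\det _); apply/matrixP=> l l'; rewrite !mxE inE.
  by rewrite (inj_eq lift_inj).
case: (unliftP j a) => [b|] ab; last by rewrite -ab aJ in jJ.
apply: (IHr _ _ b); last by rewrite inE -ab.
move=> p B /andP[p0 pr] subB; apply: M_neg; first by rewrite p0 ltnW.
exact: square_submatrix_trans (square_submatrix_minor _ _ _) subB.
Qed.

(** Each factor of the Leibniz formula is a sum of two terms; expanding the product
    chooses the rows [J] that come from [M]. *)
Lemma det_row_combination (r : nat) (M : 'M[R]_r) (E F : 'I_r -> R) :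
  \det (\matrix_(i, j) (E i * M i j + F i * (i == j)%:R)) =
  \sum_(J : {set 'I_r}) (\prod_i (if i \in J then E i else F i)) *
                        \det (select_rows J M).
Proof.
under [RHS]eq_bigr => J _ do rewrite /(\det _) mulr_sumr.
rewrite exchange_big; apply: eq_bigr => s _.
under eq_bigr => i _ do rewrite mxE.
rewrite bigA_distr mulr_sumr; apply: eq_bigr => J _.
rewrite mulrCA -big_split; congr (_ * _); apply: eq_bigr => i _.
by rewrite mxE; case: ifP.
Qed.

Definition sign_reversed (r : nat) (M : 'M[R]_r) (x : 'cV[R]_r) :=
  forall i, x i 0 * (M *m x) i 0 <= 0.

Definition sign_nonreversing (r : nat) (M : 'M[R]_r) :=
  forall x, sign_reversed M x -> x = 0.

(** With [y = M *m x], the condition [x_j y_j <= 0] says [`|x_j| y_j + `|y_j| x_j = 0],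
    so [x] is in the kernel of [T = E M + F].  As [F_i = 0], the empty principal
    minor, the only nonnegative one, drops out of the expansion of [\det T]. *)
Lemma reversed_with_zero (r : nat) (M : 'M[R]_r) (x : 'cV[R]_r) (i : 'I_r) :
  totally_negative r M -> sign_reversed M x -> (M *m x) i 0 = 0 -> x = 0.
Proof.
move=> M_neg revx yi.
pose y := M *m x.
(* The value 1 keeps E j positive wherever F j vanishes. *)
pose E j := if (x j 0 == 0) && (y j 0 == 0) then 1 else `|x j 0|.
pose F j := `|y j 0|.
pose T := \matrix_(i, j) (E i * M i j + F i * (i == j)%:R).
have Tx : T *m x = 0.
  apply/matrixP=> j a; rewrite ord1 [RHS]mxE.
  have -> : (T *m x) j 0 = E j * y j 0 + F j * x j 0.
    rewrite [LHS]mxE; under eq_bigr => l _ do rewrite mxE mulrDl -!mulrA.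
    rewrite big_split -!mulr_sumr /= -[in RHS]/(M *m x) [in RHS]mxE; congr (_ + _ * _).
    rewrite (bigD1 j) //= eqxx mul1r big1 ?addr0 // => l lj.
    by rewrite eq_sym (negPf lj) mul0r.
  have := revx j; rewrite /E /F -/y.
  case: eqP => [->|_] /=.
    by case: eqP => [->|] _; rewrite ?normr0 !(mulr0, mul0r) addr0.
  case: (ger0P (x j 0)) => x0; case: (ger0P (y j 0)) => y0 xy; nra.
have detT : \det T < 0.
  pose J := [set j | F j == 0]%SET.
  have iJ : i \in J by rewrite inE /F /y yi normr0.
  have E_ge0 j : 0 <= E j by rewrite /E; case: ifP.
  have F_ge0 j : 0 <= F j by exact: normr_ge0.
  rewrite det_row_combination (bigD1 J) //=.
  apply: ltr_wnDr.
    apply: sumr_le0 => L _; have [->|[a aL]] := set_0Vmem L.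
      by rewrite (bigD1 i) //= inE /F /y yi normr0 !mul0r.
    apply: mulr_ge0_le0; last exact/ltW/(det_select_rows_neg (a := a)).
    by apply: prodr_ge0 => j _; case: ifP.
  rewrite pmulr_rlt0; first exact: det_select_rows_neg iJ.
  apply: prodr_gt0 => j _; rewrite inE; case: ifPn => [|Fj].
    rewrite normr_eq0 /E => ->; rewrite andbT; case: ifPn => //.
    by rewrite normr_gt0.
  by rewrite lt_neqAle eq_sym Fj F_ge0.
have T_unit : T \in unitmx by rewrite unitmxE unitfE lt_eqF.
by rewrite -(mulKmx T_unit x) Tx mulmx0.
Qed.

(** Suppose [x_a > 0] and [x_b < 0]; no coordinate of [y = M *m x] is zero.
    Increasing [x_a] decreases all of [y] and keeps the vector reversed until the
    first positive coordinate of [y] reaches zero.  Then [reversed_with_zero] says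
    that the vector is zero, although its coordinate [b] has not moved. *)
Lemma reversed_one_signed (r : nat) (M : 'M[R]_r) (x : 'cV[R]_r) :
  totally_negative r M -> (forall i j, M i j < 0) -> sign_reversed M x ->
  (forall i, 0 <= x i 0) \/ (forall i, x i 0 <= 0).
Proof.
move=> M_neg M_neg1 revx.
case: (boolP [exists a, 0 < x a 0]) => [/existsP[a xa]|]; last first.
  by rewrite negb_exists => /forallP H; right=> i; rewrite leNgt.
case: (boolP [exists b, x b 0 < 0]) => [/existsP[b xb]|]; last first.
  by rewrite negb_exists => /forallP H; left=> i; rewrite leNgt.
exfalso; pose y := M *m x.
have y_neq0 i : y i 0 != 0.
  by apply/eqP=> yi; move: xa; rewrite (reversed_with_zero M_neg revx yi) mxE ltxx.
have yb : 0 < y b 0.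
  by rewrite lt_neqAle eq_sym y_neq0 /=; have := revx b; rewrite nmulr_rle0.
have ya : y a 0 < 0.
  by rewrite lt_neqAle y_neq0 /=; have := revx a; rewrite pmulr_rle0.
have [i yi imin] := @arg_minP _ _ _ b (fun i => 0 < y i 0)
  (fun i => y i 0 / - M i a) yb.
pose s := y i 0 / - M i a.
have s_gt0 : 0 < s by rewrite divr_gt0 // oppr_gt0.
pose x' := x + s *: delta_mx a 0.
have y'E j : (M *m x') j 0 = y j 0 + s * M j a.
  by rewrite mulmxDr -/y -scalemxAr -colE; move: (y) => w; rewrite !mxE.
have x'E j : x' j 0 = x j 0 + s * (j == a)%:R by rewrite !mxE andbT.
have y'i : (M *m x') i 0 = 0.
  by rewrite y'E /s invrN mulrN mulNr divfK ?subrr // lt_eqF. 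
have rev' : sign_reversed M x'.
  move=> j; have := revx j; rewrite -/y => xyj.
  have sM : s * M j a < 0 by rewrite nmulr_llt0.
  case: (ltrP 0 (y j 0)) => yj.
    have xj : x j 0 <= 0 by rewrite -(pmulr_lle0 _ yj).
    have -> : x' j 0 = x j 0.
      rewrite x'E; case: eqP => [ja|_]; rewrite ?mulr0 ?addr0 //.
      by move: ya; rewrite -ja; lra.
    rewrite mulr_le0_ge0 // y'E.
    by have := imin j yj; rewrite -/s ler_pdivlMr ?oppr_gt0 //; lra.
  have yj' : y j 0 < 0 by rewrite lt_neqAle y_neq0.
  have xj : 0 <= x j 0 by rewrite -(nmulr_lle0 _ yj').
  rewrite mulr_ge0_le0 //.
    by rewrite x'E addr_ge0 // mulr_ge0 // ltW.
  by rewrite y'E; lra.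
have := reversed_with_zero M_neg rev' y'i.
move=> /matrixP/(_ b 0); rewrite x'E mxE.
case: eqP => [ba|_]; last by move=> e; move: xb; rewrite mulr0 addr0 in e; rewrite e ltxx.
by move: xa; rewrite -ba; lra.
Qed.

Lemma SOL_sub_reversed (r : nat) (M : 'M[R]_r) (q x y : 'cV[R]_r) :
  SOL M q x -> SOL M q y -> sign_reversed M (x - y).
Proof.
move=> /SOLP Sx /SOLP Sy i.
have -> : (M *m (x - y)) i 0 = (M *m x + q) i 0 - (M *m y + q) i 0.
  by rewrite mulmxBr; move: (M *m x) (M *m y) => u v; rewrite !mxE; ring.
have -> : (x - y) i 0 = x i 0 - y i 0 by rewrite !mxE.
by have [x0 wx0 xw] := Sx i; have [y0 wy0 yw] := Sy i; nra.
Qed.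

Lemma nonreversing_SOL_unique (r : nat) (K : 'M[R]_r) (q x y : 'cV[R]_r) :
  sign_nonreversing K -> SOL K q x -> SOL K q y -> x = y.
Proof.
by move=> nrK Sx Sy; apply: subr0_eq; apply: nrK; apply: SOL_sub_reversed Sx Sy.
Qed.

End SignReversal.

(** * Complementarity problems along a line *)

Lemma segment_closed_cover (R : realType) (a b : R) (A B : set R) :
  a <= b -> closed A -> closed B -> A a -> B b ->
  (forall t, a <= t <= b -> A t \/ B t) ->
  exists t, [/\ a <= t <= b, A t & B t].
Proof.
move=> ab cA cB Aa Bb cover; apply: contrapT => noAB.
have AE : `[a, b] `&` A = `[a, b].
  apply: (@segment_connected R a b).
  - by exists a; split=> //=; rewrite in_itv /= lexx ab.
  - exists (~` B); first exact: closed_openC.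
    apply/seteqP; split=> t [] /=; rewrite in_itv /= => abt.
      by move=> At; split=> // Bt; apply: noAB; exists t.
    by move=> nBt; split=> //; case: (cover t abt).
  - by exists A.
have : (`[a, b] `&` A) b by rewrite AE /= in_itv /= lexx ab.
by case=> _ Ab; apply: noAB; exists b; rewrite ab lexx.
Qed.

Lemma closed_affine_ge0 (R : realType) (f : R -> R) (u v : R) :
  (forall t, f t = u + t * v) -> closed [set t : R | 0 <= f t].
Proof.
move=> /funext ->.
apply: (preimage_closed (D := [set x : R | 0 <= x])); last exact: closed_ge.
move=> t _; apply: cvgD; first exact: cvg_cst.
by apply: cvgM; [exact: cvg_id|exact: cvg_cst].
Qed.

Lemma closed_exists (R : realType) (I : finType) (A : I -> set R) :
  (forall i, closed (A i)) -> closed [set t | exists i, A i t].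
Proof.
move=> cA; have -> : [set t | exists i, A i t] = \bigcup_(i in [set: I]) A i.
  by apply/seteqP; split=> t [i] //=; exists i.
by apply: closed_bigcup => //; exact: finite_finset.
Qed.

Lemma closed_forall (R : realType) (I : Type) (A : I -> set R) :
  (forall i, closed (A i)) -> closed [set t | forall i, A i t].
Proof.
move=> cA; have -> : [set t | forall i, A i t] = \bigcap_(i in [set: I]) A i.
  by apply/seteqP; split=> t H i //; exact: H.
by apply: closed_bigI.
Qed.

Section LinearComplementarity.
Variable R : realType.

Lemma select_rows_mul (r : nat) (S : {set 'I_r}) (K : 'M[R]_r) (x : 'cV[R]_r)
    (i : 'I_r) :
  (select_rows S K *m x) i 0 = if i \in S then (K *m x) i 0 else x i 0.
Proof.
rewrite mxE; under eq_bigr => l _ do rewrite mxE.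
case: ifP => iS; first by rewrite mxE.
rewrite (bigD1 i) //= eqxx mul1r big1 ?addr0 // => l li.
by rewrite eq_sym (negPf li) mul0r.
Qed.

Lemma nonreversing_select_rows_unit (r : nat) (S : {set 'I_r}) (K : 'M[R]_r) :
  sign_nonreversing K -> select_rows S K \in unitmx.
Proof.
move=> nrK; rewrite unitmxE unitfE -det_tr; apply/det0P => -[v v0 vT].
suff /(congr1 trmx) : v^T = 0 by rewrite trmxK trmx0 => /eqP; rewrite (negPf v0).
have Kv : select_rows S K *m v^T = 0 by rewrite -[LHS]trmxK trmx_mul trmxK vT trmx0.
apply: nrK => i; have := select_rows_mul S K v^T i; rewrite Kv [LHS]mxE.
by case: ifP => _ <-; rewrite ?mulr0 ?mul0r.
Qed.

(** Applied to [q], this matrix gives the solution of the linear system that makes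
    the slack vanish on [S] and the vector vanish off [S]. *)
Definition basic_solution (r : nat) (K : 'M[R]_r) (S : {set 'I_r}) : 'M[R]_r :=
  - (invmx (select_rows S K) *m diag_mx (\row_i (i \in S)%:R)).

Lemma basic_solutionP (r : nat) (K : 'M[R]_r) (S : {set 'I_r}) (q z : 'cV[R]_r) :
  sign_nonreversing K ->
  (forall i, if i \in S then (K *m z + q) i 0 = 0 else z i 0 = 0) <->
  z = basic_solution K S *m q.
Proof.
move=> nrK; have GU := nonreversing_select_rows_unit S nrK.
set D := diag_mx (\row_i (i \in S)%:R : 'rV[R]_r).
have DE i : (D *m q) i 0 = if i \in S then q i 0 else 0.
  by rewrite mul_diag_mx !mxE; case: ifP; rewrite ?mul1r ?mul0r.
have GE : select_rows S K *m z = - (D *m q) <->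
    (forall i, if i \in S then (K *m z + q) i 0 = 0 else z i 0 = 0).
  split=> [/matrixP Gz i|H].
    have := Gz i 0; rewrite select_rows_mul [RHS]mxE DE.
    by case: ifP => _ e; rewrite ?e ?oppr0 // mxE e addNr.
  apply/matrixP => i a; rewrite ord1 select_rows_mul [RHS]mxE DE.
  have := H i; case: ifP => _; last by rewrite oppr0.
  by rewrite mxE => /eqP; rewrite addr_eq0 => /eqP.
rewrite -GE /basic_solution -/D mulNmx -mulmxA; split=> [Gz|->].
  by rewrite -mulmxN -Gz mulKmx.
by rewrite mulmxN mulKVmx.
Qed.

(** For each set [S], the parameters [t] at which the basic solution for [S] is
    feasible form a closed set, on which the functional is affine in [t].  These
    finitely many sets cover the segment, so the set where the functional is
    nonpositive at some solution and the set where it is nonnegative at some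
    solution are closed and cover the connected segment [a, b]: they meet, and
    uniqueness of the solution makes the functional zero there. *)
Lemma nonreversing_line_ivt (r : nat) (K : 'M[R]_r) (p d : 'cV[R]_r)
    (c : 'rV[R]_r) (u v a b : R) (za zb : 'cV[R]_r) :
  sign_nonreversing K -> (forall q, exists x, SOL K q x) -> a <= b ->
  SOL K (p + a *: d) za -> u + a * v + (c *m za) 0 0 <= 0 ->
  SOL K (p + b *: d) zb -> 0 <= u + b * v + (c *m zb) 0 0 ->
  exists t z, [/\ a <= t <= b, SOL K (p + t *: d) z
                 & u + t * v + (c *m z) 0 0 = 0].
Proof.
move=> nrK solvable ab Sza a_le0 Szb b_ge0.
pose L S := basic_solution K S.
have lineE m (W : 'M[R]_(m, r)) t i :
    (W *m (p + t *: d)) i 0 = (W *m p) i 0 + t * (W *m d) i 0.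
  by rewrite mulmxDr -scalemxAr; move: (W *m p) (W *m d) => x y; rewrite !mxE.
pose z S t := L S *m (p + t *: d).
pose feas S := [set t | forall i, 0 <= z S t i 0] `&`
               [set t | forall i, 0 <= (K *m z S t + (p + t *: d)) i 0].
have feasP S t : feas S t -> SOL K (p + t *: d) (z S t).
  move=> [z0 w0]; apply/SOLP=> i; split=> //.
  have := (basic_solutionP S (p + t *: d) (z S t) nrK).2 erefl i.
  by case: ifP => _ ->; rewrite ?mulr0 ?mul0r.
have feas_ex t x : SOL K (p + t *: d) x -> exists2 S, feas S t & x = z S t.
  move=> /SOLP Sx; pose S := [set i | (K *m x + (p + t *: d)) i 0 == 0]%SET.
  have xE : x = z S t.
    apply/(basic_solutionP S _ _ nrK) => i; rewrite inE.
    case: eqP => // /eqP w0; have [_ _ /eqP] := Sx i.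
    by rewrite mulf_eq0 (negPf w0) orbF => /eqP.
  exists S => //; split=> i; rewrite -xE; by have [] := Sx i.
have closed_feas S : closed (feas S).
  apply: closedI; apply: closed_forall => i; apply: closed_affine_ge0 => t.
    exact: lineE.
  transitivity (((K *m L S + 1%:M) *m (p + t *: d)) i 0); last exact: lineE.
  by rewrite mulmxDl mul1mx -mulmxA.
pose phi S t := u + t * v + (c *m z S t) 0 0.
have phiE S t : phi S t = u + (c *m L S *m p) 0 0 + t * (v + (c *m L S *m d) 0 0).
  by rewrite /phi /z mulmxA lineE; ring.
have [|||||t [abt [S [fS phiS]] [S' [fS' phiS']]]] := @segment_closed_cover _ a b
    [set t | exists S, (feas S `&` [set t | 0 <= - phi S t]) t]
    [set t | exists S, (feas S `&` [set t | 0 <= phi S t]) t] ab.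
- apply: closed_exists => S; apply: closedI => //.
  apply: (closed_affine_ge0 (f := fun t => - phi S t)) => t.
  by rewrite phiE opprD -mulrN.
- apply: closed_exists => S; apply: closedI => //.
  by apply: closed_affine_ge0 => t; exact: phiE.
- by have [S fS zE] := feas_ex _ _ Sza; exists S; split=> //=; rewrite oppr_ge0 /phi -zE.
- by have [S fS zE] := feas_ex _ _ Szb; exists S; split=> //=; rewrite /phi -zE.
- move=> t _; have [x /feas_ex[S fS zE]] := solvable (p + t *: d).
  have [le0|/ltW ge0] := lerP (phi S t) 0; first by left; exists S; split=> //=; rewrite oppr_ge0.
  by right; exists S.
exists t, (z S t); split=> //; first exact: feasP.
have zz : z S' t = z S t by apply: nonreversing_SOL_unique nrK _ _; apply: feasP.
apply: le_anti; rewrite -oppr_ge0 -/(phi S t) phiS /=.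
by move: phiS'; rewrite /= /phi zz.
Qed.

Definition cons_col (r : nat) (s : R) (z : 'cV[R]_r) : 'cV[R]_r.+1 :=
  \col_i oapp (fun j => z j 0) s (unlift ord0 i).

Lemma cons_col0 (r : nat) (s : R) (z : 'cV[R]_r) : cons_col s z ord0 0 = s.
Proof. by rewrite mxE unlift_none. Qed.

Lemma cons_colS (r : nat) (s : R) (z : 'cV[R]_r) j :
  cons_col s z (lift ord0 j) 0 = z j 0.
Proof. by rewrite mxE liftK. Qed.

Lemma mulmx_cons_col (r : nat) (M : 'M[R]_r.+1) (s : R) (z : 'cV[R]_r) i :
  (M *m cons_col s z) i 0 = M i ord0 * s + \sum_l M i (lift ord0 l) * z l 0.
Proof.
rewrite mxE big_ord_recl cons_col0; congr (_ + _).
by apply: eq_bigr => l _; rewrite cons_colS.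
Qed.

(** Induction on the size.  If setting [x_0 = 0] leaves the slack at [0] negative,
    give [x_0] the homogeneous value [t / (1 - t)]: the other coordinates then solve,
    up to the factor [1 - t], the problem with right-hand side [(1 - t) q' + t m].
    At the infinite end [t = 1] the slack at [0] is positive because [M] does not
    reverse [cons_col 1 z], so it vanishes for some [t < 1]. *)
Lemma nonreversing_solvable (r : nat) (M : 'M[R]_r) (q : 'cV[R]_r) :
  sign_nonreversing M -> exists x, SOL M q x.
Proof.
elim: r M q => [|r IHr] M q nrM; first by exists 0; apply/SOLP => -[].
pose K := row' ord0 (col' ord0 M); pose q' := \col_j q (lift ord0 j) 0.
pose m := \col_j M (lift ord0 j) ord0; pose c := \row_l M ord0 (lift ord0 l).
have rowS s z j : (M *m cons_col s z) (lift ord0 j) 0 = s * m j 0 + (K *m z) j 0.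
  rewrite mulmx_cons_col !mxE mulrC; congr (_ + _).
  by apply: eq_bigr => l _; rewrite !mxE.
have row0 s z : (M *m cons_col s z) ord0 0 = s * M ord0 ord0 + (c *m z) 0 0.
  rewrite mulmx_cons_col mulrC !mxE; congr (_ + _).
  by apply: eq_bigr => l _; rewrite !mxE.
have nrK : sign_nonreversing K.
  move=> z revz; have e : cons_col 0 z = 0.
    apply: nrM => i; case: (unliftP ord0 i) => [j|] ->.
      by rewrite cons_colS rowS mul0r add0r.
    by rewrite cons_col0 mul0r.
  by apply/matrixP=> i a; rewrite ord1 -(cons_colS 0) e !mxE.
have end1 z : SOL K m z -> 0 < M ord0 ord0 + (c *m z) 0 0.
  move=> /SOLP Sz; rewrite ltNge; apply/negP => le0.
  have e : cons_col 1 z = 0.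
    apply: nrM => i; case: (unliftP ord0 i) => [j|] ->.
      by have [_ _] := Sz j; rewrite cons_colS rowS mul1r addrC mxE => ->.
    by rewrite cons_col0 row0 !mul1r.
  by have := cons_col0 1 z; rewrite e mxE => /esym/eqP; rewrite oner_eq0.
have [z0 Sz0] := IHr K q' nrK; have [z1 Sz1] := IHr K m nrK.
have q'E j : q' j 0 = q (lift ord0 j) 0 by rewrite mxE.
have [ge0|lt0] := lerP 0 (q ord0 0 + (c *m z0) 0 0).
  exists (cons_col 0 z0); apply/SOLP => i; case: (unliftP ord0 i) => [j|] ->.
    have /SOLP/(_ j) := Sz0.
    by rewrite cons_colS !colD rowS mul0r add0r q'E.
  by rewrite cons_col0 colD row0 !mul0r add0r addrC.
pose q0 := q ord0 0.
have [|||||t [z [/andP[t0 t1] Sz phi0]]] :=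
  @nonreversing_line_ivt _ K q' (m - q') c q0 (M ord0 ord0 - q0) 0 1 z0 z1 nrK
    (fun q => IHr K q nrK).
- exact: ler01.
- by rewrite scale0r addr0.
- by rewrite mul0r addr0 ltW.
- by rewrite scale1r addrC subrK.
- by rewrite mul1r [q0 + _]addrC subrK ltW ?end1.
have {}t1 : t < 1.
  rewrite lt_neqAle t1 andbT; apply/eqP => te; move: Sz phi0.
  rewrite te scale1r mul1r [q' + _]addrC [q0 + _]addrC !subrK => /end1 pos e.
  by rewrite e ltxx in pos.
pose s := (1 - t)^-1; have s_gt0 : 0 < s by rewrite invr_gt0 subr_gt0.
have s1 : s * (1 - t) = 1 by rewrite mulVf // gt_eqF // subr_gt0.
exists (cons_col (s * t) (s *: z)); apply/SOLP => i.
case: (unliftP ord0 i) => [j|] ->; last first.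
  rewrite cons_col0 colD row0 -scalemxAr colZ.
  have -> : s * t * M ord0 ord0 + s * (c *m z) 0 0 + q ord0 0 = 0; last first.
    by rewrite lexx mulr0 mulr_ge0 // ltW.
  rewrite -[RHS](mulr0 s) -phi0 -/q0 -[q0 in LHS]mul1r -s1; ring.
rewrite cons_colS colD rowS -scalemxAr !colZ.
have -> : s * t * m j 0 + s * (K *m z) j 0 + q (lift ord0 j) 0 =
    s * (K *m z + (q' + t *: (m - q'))) j 0.
  rewrite -q'E -[q' j 0 in LHS]mul1r -s1 !colD colZ colD colN; ring.
have /SOLP/(_ j)[z_ge0 w_ge0 zw] := Sz.
by split; [rewrite mulr_ge0 // ltW|rewrite mulr_ge0 // ltW|rewrite mulrACA zw mulr0].
Qed.

(** * The two solutions of a totally negative problem *)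

Lemma small_enough (r : nat) (a q : 'I_r -> R) : (forall i, 0 < q i) ->
  exists2 e, 0 < e & forall i, e * a i <= q i.
Proof.
move=> q_gt0; pose S := \sum_i `|a i| / q i.
have term_ge0 i : 0 <= `|a i| / q i by rewrite divr_ge0 // ltW.
have S_ge0 : 0 <= S by apply: sumr_ge0.
exists (1 + S)^-1 => [|i]; first by rewrite invr_gt0 ltr_wpDr.
rewrite mulrC ler_pdivrMr ?ltr_wpDr // (le_trans (ler_norm _)) //.
rewrite mulrC -ler_pdivrMr //.
rewrite /S (bigD1 i) //= addrCA lerDl addr_ge0 //.
by apply: sumr_ge0.
Qed.

(** [K] is the Schur complement of [M] at its entry [(0, 0)], and [lead t z] is the
    value of [x_0] for which the slack at [0] equals [t] when the other coordinates
    are [z].  A vector reversed by [K] lifts to a vector [x] reversed by [M] with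
    [(M x)_0 = 0], so [K] reverses only zero by [reversed_with_zero]. *)
Lemma nonzero_solution (r : nat) (M : 'M[R]_r.+1) (q : 'cV[R]_r.+1) :
  totally_negative r.+1 M -> (forall i j, M i j < 0) -> vpos q ->
  exists2 x, SOL M q x & x <> 0.
Proof.
move=> M_neg M_neg1 q_gt0; set m00 := M ord0 ord0.
have m00_lt0 : m00 < 0 by exact: M_neg1.
have m00_neq0 : m00 != 0 by rewrite lt_eqF.
pose c := \row_l M ord0 (lift ord0 l).
pose b := \col_j (M (lift ord0 j) ord0 / m00).
pose K := \matrix_(j, l) (M (lift ord0 j) (lift ord0 l) - b j 0 * c 0 l).
pose lead t (z : 'cV[R]_r) := (t - q ord0 0 - (c *m z) 0 0) / m00.
have row0 t z : (M *m cons_col (lead t z) z) ord0 0 = t - q ord0 0.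
  rewrite mulmx_cons_col mulrC divfK // addrC [(c *m z) 0 0]mxE.
  by under [X in _ - X]eq_bigr => l _ do rewrite mxE; rewrite addrC subrK.
have rowS t z j : (M *m cons_col (lead t z) z) (lift ord0 j) 0 =
    (K *m z) j 0 + (t - q ord0 0) * b j 0.
  have -> : (K *m z) j 0 = \sum_l M (lift ord0 j) (lift ord0 l) * z l 0
                           - b j 0 * (c *m z) 0 0.
    rewrite !(mxE, mulr_sumr) -sumrB; apply: eq_bigr => l _.
    by rewrite !mxE; ring.
  by rewrite mulmx_cons_col /lead [b j 0]mxE; field.
have nrK : sign_nonreversing K.
  move=> z revz; pose x := cons_col (lead (q ord0 0) z) z.
  have x_0 : (M *m x) ord0 0 = 0 by rewrite row0 subrr.
  have e : x = 0.
    apply: (reversed_with_zero M_neg _ x_0) => i.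
    case: (unliftP ord0 i) => [j|] ->; last by rewrite x_0 mulr0.
    by rewrite cons_colS rowS subrr mul0r addr0.
  by apply/matrixP=> i a; rewrite ord1 -(cons_colS (lead (q ord0 0) z)) -/x e !mxE.
pose q' := \col_j q (lift ord0 j) 0.
pose p := q' - q ord0 0 *: b.
have SOL_line t z : 0 <= t -> t < q ord0 0 -> SOL K (p + t *: b) z ->
    0 <= lead t z -> lead t z * t = 0 -> exists2 x, SOL M q x & x <> 0.
  move=> t_ge0 t_lt /SOLP Sz lead_ge0 comp0; exists (cons_col (lead t z) z).
    apply/SOLP => i; case: (unliftP ord0 i) => [j|] ->; last first.
      by rewrite cons_col0 colD row0 subrK.
    rewrite cons_colS colD rowS.
    have -> : (K *m z) j 0 + (t - q ord0 0) * b j 0 + q (lift ord0 j) 0 =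
              (K *m z + (p + t *: b)) j 0; last by [].
    by rewrite /p !(colD, colN, colZ) [q' j 0]mxE; ring.
  move=> x0; have := row0 t z; rewrite x0 mulmx0 mxE => /esym/eqP.
  by rewrite subr_eq0 => /eqP tq; rewrite tq ltxx in t_lt.
have [z0 Sz0] := nonreversing_solvable (p + 0 *: b) nrK.
have [ge0|lt0] := lerP 0 (lead 0 z0).
  by apply: SOL_line Sz0 ge0 _ => //; rewrite mulr0.
(* For t = q_0 - e the vector z = 0 still solves the problem for K. *)
have [e e_gt0 e_small] := small_enough (fun i => cons_col 1 b i 0) q_gt0.
have e_le : e <= q ord0 0 by have := e_small ord0; rewrite cons_col0 mulr1.
have [||||t [z [/andP[t0 t1] Sz phi0]]] :=
  @nonreversing_line_ivt _ K p b c (q ord0 0) (-1) 0 (q ord0 0 - e) z0 0 nrK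
    (fun q => nonreversing_solvable q nrK) _ Sz0.
- by rewrite subr_ge0.
- rewrite mul0r addr0; move: lt0.
  by rewrite /lead sub0r nmulr_llt0 ?invr_lt0 // => /ltW; lra.
- apply/SOLP => j; rewrite mulmx0 add0r col0 mul0r; split=> //.
  have := e_small (lift ord0 j); rewrite cons_colS => ej.
  rewrite /p !(colD, colN, colZ) [q' j 0]mxE; lra.
- by rewrite mulmx0 mxE addr0; lra.
have lead0 : lead t z = 0.
  by rewrite /lead; have -> : t - q ord0 0 - (c *m z) 0 0 = 0; [lra|rewrite mul0r].
by apply: SOL_line Sz _ _ => //; rewrite ?lead0 ?mul0r //; lra.
Qed.

Lemma totally_negative_two_solutions (r : nat) (M : 'M[R]_r) (q : 'cV[R]_r) :
  (0 < r)%N -> totally_negative r M -> vpos q -> exactly_two_solutions M q.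
Proof.
case: r M q => // r M q _ M_neg q_gt0.
have M_neg1 := totally_negative_entry M_neg.
have [x Sx x0] := nonzero_solution M_neg M_neg1 q_gt0.
have S0 : SOL M q 0.
  apply/SOLP => i; rewrite mulmx0 add0r col0 mul0r lexx.
  by split=> //; apply: ltW.
(* Where w is positive its slack is zero, and the slack of y would be negative. *)
have bigger y w : SOL M q y -> SOL M q w -> (forall i, 0 <= (y - w) i 0) ->
    y = w \/ w = 0.
  move=> /SOLP Sy /SOLP Sw yw.
  case: (boolP [exists j, 0 < (y - w) j 0]) => [/existsP[j yj]|].
    right; have lt_w := neg_mulmx_lt0 M_neg1 yw yj.
    apply/matrixP=> i a; rewrite ord1 [RHS]mxE.
    have [_ _ /eqP] := Sw i; rewrite mulf_eq0 => /orP[/eqP //|/eqP wi0].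
    have [_ + _] := Sy i; have := lt_w i; rewrite mulmxBr !(colD, colN).
    by move: wi0; rewrite colD; lra.
  rewrite negb_exists => /forallP le0; left; apply/matrixP=> i a; rewrite ord1.
  by have := yw i; have := le0 i; rewrite -leNgt !(colD, colN); lra.
exists 0, x; split; first by move=> e; apply: x0.
apply/seteqP; split=> y /=; last by case=> ->.
move=> Sy; have [yx|xy] := reversed_one_signed M_neg M_neg1 (SOL_sub_reversed Sy Sx).
  by have [->|/x0] := bigger y x Sy Sx yx; [right|].
have [|->|->] := bigger x y Sx Sy; [|by right|by left].
by move=> i; have := xy i; rewrite !(colD, colN); lra.
Qed.

End LinearComplementarity.

Theorem theorem4 (R : realType) (m n k : nat)
    (hkm : (k <= m)%N) (hkn : (k <= n)%N) (hk : (1 <= k)%N)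
    (A : 'M[R]_(m, n)) :
  [<->
    totally_negative k A;
    forall (r : nat) (B : 'M[R]_r), (1 <= r <= k)%N ->
      square_submatrix A B ->
      forall q : 'cV[R]_r, vpos q -> exactly_two_solutions B q;
    forall (r : nat) (B : 'M[R]_r), (1 <= r <= k)%N ->
      contiguous_square_submatrix A B ->
      forall q : 'cV[R]_r, vpos q -> exactly_two_solutions B q;
    (forall (r : nat) (B : 'M[R]_r), (2 <= r <= k)%N ->
      contiguous_square_submatrix A B ->
      forall q : 'cV[R]_r, vpos q ->
      ~ (exists x y : 'cV[R]_r,
           [/\ SOL B q x, SOL B q y,
               sign_pattern_plus_zero x & sign_pattern_zero_plus y]))
    /\ (forall (i : 'I_m) (j : 'I_n), exists q : R,
          0 < q /\
          exactly_two_solutions (const_mx (A i j) : 'M[R]_1)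
                                (const_mx q : 'cV[R]_1))].
Proof.
tfae.
- move=> A_neg r B /andP[r_gt0 rk] subB q q_gt0.
  apply: totally_negative_two_solutions => // p C /andP[p_gt0 pr] subC.
  apply: A_neg; first by rewrite p_gt0 (leq_trans pr).
  exact: square_submatrix_trans subB subC.
- move=> two r B rk [f [g [[f_incr _] [g_incr _] BE]]]; apply: two => //.
  by exists f, g.
- move=> two; split=> [r B /andP[r2 rk] contB q q_gt0 [x [y [Sx Sy px py]]]|i j].
    have r_gt0 : (0 < r)%N by rewrite ltnW.
    have S0 : SOL B q 0.
      apply/SOLP => i; rewrite mulmx0 add0r col0 mul0r lexx.
      by split=> //; apply: ltW.
    have x0 : 0 < x (Ordinal r_gt0) 0 by apply: (px _).1.
    have y1 : 0 < y (Ordinal r2) 0 by apply: (py _).2.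
    have y0 : y (Ordinal r_gt0) 0 = 0 by apply: (py _).1.
    have [|u [v [_ SE]]] := two r B _ contB q q_gt0; first by rewrite r_gt0.
    have nx0 : x <> 0 by move=> e; move: x0; rewrite e mxE ltxx.
    have ny0 : y <> 0 by move=> e; move: y1; rewrite e mxE ltxx.
    have nxy : x <> y by move=> e; move: x0; rewrite e y0 ltxx.
    move: Sx Sy S0; rewrite SE /= => -[xE|xE] [yE|yE] zE.
    - by apply: nxy; rewrite xE yE.
    - by case: zE => zE; [apply: nx0; rewrite xE zE|apply: ny0; rewrite yE zE].
    - by case: zE => zE; [apply: ny0; rewrite yE zE|apply: nx0; rewrite xE zE].
    - by apply: nxy; rewrite xE yE.
  exists 1; split=> //; apply: two => //; last by move=> a; rewrite mxE.
  exists (fun=> i), (fun=> j).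
  split; last by apply/matrixP=> a b; rewrite !mxE.
    by split=> a b; rewrite !ord1.
  by split=> a b; rewrite !ord1.
- move=> [no_alt two].
  have A_neg1 i j : A i j < 0.
    rewrite ltNge; apply/negP => a_ge0.
    have [q [q_gt0 [x [y [xy SE]]]]] := two i j.
    suff SOL0 z : SOL (const_mx (A i j) : 'M_1) (const_mx q) z -> z = 0.
      have Sx : SOL (const_mx (A i j) : 'M_1) (const_mx q) x by rewrite SE; left.
      have Sy : SOL (const_mx (A i j) : 'M_1) (const_mx q) y by rewrite SE; right.
      by apply: xy; rewrite (SOL0 x Sx) (SOL0 y Sy).
    move=> /SOLP/(_ 0)[z_ge0 _ /eqP]; rewrite mulf_eq0 => /orP[/eqP z0|].
      by apply/matrixP=> a b; rewrite !ord1 z0 mxE.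
    rewrite colD !mxE big_ord1 mxE gt_eqF //.
    by rewrite ltr_wpDl // mulr_ge0.
  suff : forall p, (p <= k)%N -> totally_negative p A by apply.
  elim=> [_ r B|p IHp ltpk]; first by case: r B.
  by apply: contiguous_order_step ltpk (IHp (ltnW ltpk)) A_neg1 no_alt.
Qed.
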